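(* For every $k \geq 3$ we have $$N_k(2,n)=t_{k-1}((2-o(1))n) ,$$ where the $o(1)$ term goes to $0$ as $n \rightarrow \infty$; that is, for every $k\ge 3$ there is a real sequence $\varepsilon_k(n)$ with $\varepsilon_k(n)\to 0$ as $n\to\infty$ such that $N_k(2,n)=t_{k-1}((2-\varepsilon_k(n))n)$.
   Context: The parameters $k,n$ are integers. Let $K^k_N$ denote the complete $k$-uniform hypergraph on the ordered vertex set $\{1,\ldots,N\}$, i.e. all $k$-element subsets of $\{1,\ldots,N\}$. For vertices $x_1<x_2<\cdots<x_{n+k-1}$, the $n$ edges $\{x_i,x_{i+1},\ldots,x_{i+k-1}\}$, $1\le i\le n$, form a monotone path of length $n$ (length is the number of edges). $N_k(2,n)$ is the smallest integer $N$ such that every coloring of the edges of $K^k_N$ with $2$ colors contains a monochromatic monotone path of length $n$ (all $n$ edges having the same color). The tower function $t_k(x)$ (for real $x$) is a tower of exponents (of base $2$) of height $k-1$ with $x$ at the top: $t_1(x)=x$ and $t_k(x)=2^{t_{k-1}(x)}$ for $k\ge 2$ (so $t_3(x)=2^{2^x}$).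
   Formalization: The equality is asserted for all sufficiently large n (depending on k) rather than for every n; for every n it fails, e.g. N_7(2,1)=7 while t_6(x)>16 for all real x. *)

(* Defs.v *)
From mathcomp Require Import all_boot all_order all_algebra.
From mathcomp Require Import all_classical all_reals all_analysis.

Set Implicit Arguments.
Unset Strict Implicit.
Unset Printing Implicit Defensive.

(* Vertices are 'I_N = {0, ..., N-1}, so all indices are shifted down by one. *)
Section MonotonePaths.
Variables (k N : nat).
Implicit Types x : seq 'I_N.

Definition increasing_vertices n x : bool :=
  (size x == n + k - 1) && sorted (fun a b : 'I_N => a < b) x.

(* The set {x_i, ..., x_(i+k-1)}; its k elements are distinct when x is the
   vertex sequence of a monotone path of length n and i < n. *)
Definition path_edge x (i : nat) : {set 'I_N} :=
  finset (fun v => v \in take k (drop i x)).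

(* A colouring of the complete k-uniform hypergraph is given by a total map on
   {set 'I_N}; only its values on k-element sets are ever used. *)
Definition has_mono_path q n (c : {set 'I_N} -> 'I_q) : Prop :=
  exists2 x : seq 'I_N, increasing_vertices n x &
  exists a : 'I_q, forall i, i < n -> c (path_edge x i) = a.

End MonotonePaths.

Definition forces_mono_path k q n N : Prop :=
  forall c : {set 'I_N} -> 'I_q, has_mono_path k n c.

Definition least_forcing k q n N : Prop :=
  forces_mono_path k q n N /\
  forall M, forces_mono_path k q n M -> N <= M.

(* N_k(q, n). There is at most one N with [least_forcing k q n N]; the default
   0 of xget would only be returned if there were none. *)
Definition path_ramsey k q n : nat :=
  xget 0 (fun N => least_forcing k q n N).

(* t_k(x), for k >= 1: k - 1 twos below x. *)
Definition tower {R : realType} (k : nat) (x : R) : R :=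
  iter k.-1 (fun y : R => powR 2%:R y) x.

(* Main.v *)
Require Import Defs.
From HB Require Import structures.
From mathcomp Require Import all_boot all_order all_algebra.
From mathcomp Require Import all_classical all_reals all_analysis.
From mathcomp Require Import zify ring lra.
Import Order.TTheory GRing.Theory Num.Theory.
Import numFieldNormedType.Exports.
Import fintype finset.

(** Fix a colouring of the [k]-subsets of an ordered [N]-set. Recording, for
each increasing [(k-1)]-tuple and each colour, the length of the longest monotone
path of that colour ending in the tuple gives labels in the box [[n]^q], and
sliding the tuple by one vertex raises at least one coordinate. So the absence
of monochromatic monotone paths of length [n] amounts to a labelling [f] of
the [(k-1)]-tuples by a poset [P = [n]^q] such that
[f (x_2, ..., x_k) <= f (x_1, ..., x_(k-1))] never holds
([labelling_of_colouring], [colouring_of_labelling]).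

Such labellings of [j+1]-tuples in [P] are equivalent to such labellings of
[j]-tuples in the lattice [J P] of down-closed subsets of [P]
([tuple_labelling_down], [tuple_labelling_up]). After [k-2] steps vertices are
labelled, and the condition only asks for distinct labels along a linear
extension; hence [N_k(q,n)] is one more than the size of the [(k-2)]-fold
iterate of [J] on [[n]^q].

For [q = 2], lattice paths give [|J [n]^2| = C(2n, n)], and each further
[J] at most exponentiates the size, so [N_k(2,n) <= t_(k-1)(2n)]
([forces_mono_path_large], [central_bin_lt]). From below it is enough to
follow antichains instead of whole posets: one level (by cardinality) of
[J [n]^2] is an antichain of size at least [C(2n, n) / (n^2 + 1)] ([ideal_level_antichain]),
and an antichain of size [2m] in [P] yields one of size [2^m] in [J P]
([has_antichain_ideal]). Losing a factor [2] in an exponent is harmless: an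
antichain of size [4y] becomes one of size [2^(2y) >= 4 * 2^y], so that
[N_k(2,n)] exceeds the [(k-3)]-fold exponential of [y = 2^(2n - O(sqrt n))]
([path_ramsey_gt]). Inverting the tower between the two bounds produces an
exponent [x] with [2n - O(sqrt n) <= x <= 2n], and [2 - x/n] is the error
term ([path_ramsey_exponent]). *)

(** * Down-closed sets *)

Definition down_closed {P : finType} (le : rel P) (D : {set P}) : bool :=
  [forall q in D, forall p, le p q ==> (p \in D)].

Lemma down_closedP {P : finType} {le : rel P} {D : {set P}} :
  reflect (forall p q, le p q -> q \in D -> p \in D) (down_closed le D).
Proof.
apply: (iffP forall_inP) => [dcD p q pq qD | dcD q qD].
  by move/forallP/(_ p)/implyP: (dcD q qD); apply.
by apply/forallP => p; apply/implyP => pq; apply: dcD pq qD.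
Qed.

Definition ideal {P : finType} (le : rel P) := {D : {set P} | down_closed le D}.

HB.instance Definition _ (P : finType) (le : rel P) := Finite.on (ideal le).

Definition ideal_le {P : finType} (le : rel P) : rel (ideal le) :=
  fun D E => val D \subset val E.

Lemma ideal_le_refl {P : finType} (le : rel P) : reflexive (ideal_le le).
Proof. by move=> D; apply: subxx. Qed.

Lemma ideal_le_trans {P : finType} (le : rel P) : transitive (ideal_le le).
Proof. by move=> E D F; apply: subset_trans. Qed.

Lemma card_ideal_le {P : finType} (le : rel P) : #|{: ideal le}| <= 2 ^ #|P|.
Proof.
rewrite -[X in 2 ^ X]cardsT -card_powerset powersetT cardsT.
exact: leq_card _ val_inj.
Qed.

(** * Labellings of tuples *)

(** The increasing [j+1]-tuples of vertices are labelled, so that [j = 0] stands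
for labels on the vertices themselves. *)
Definition tuple_labelling (P : finType) (le : rel P) (j N : nat) : Prop :=
  exists f : seq 'I_N -> P, forall a (s : seq 'I_N) b,
    size s = j -> sorted ltn (map val (a :: rcons s b)) ->
    ~~ le (f (rcons s b)) (f (a :: s)).

(** The tuple [y] receives the down-closure of the labels of its extensions
[w :: y] to the left. The label of [x_1, ..., x_m] belongs to the set of
[x_2, ..., x_m], but not to that of [x_1, ..., x_(m-1)], since it would then lie
below the label of some [w, x_1, ..., x_(m-1)]. *)
Lemma tuple_labelling_down {P : finType} {le : rel P} {j N} :
  reflexive le -> transitive le ->
  tuple_labelling P le j.+1 N -> tuple_labelling (ideal le) (ideal_le le) j N.
Proof.
move=> le_refl le_trans [f fP].
pose srt (s : seq 'I_N) := sorted ltn (map val s).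
pose D y : {set P} := \bigcup_(w | srt (w :: y)) [set p | le p (f (w :: y))].
have dcD y : down_closed le (D y).
  apply/down_closedP => p q pq /bigcupP[w wy]; rewrite inE => qw.
  by apply/bigcupP; exists w => //; rewrite inE (le_trans q).
exists (fun y => exist _ (D y) (dcD y)) => a s b sz sab.
apply/negP => /subsetP/(_ (f (a :: rcons s b))) /=.
have -> : f (a :: rcons s b) \in D (rcons s b).
  by apply/bigcupP; exists a => //; rewrite inE.
move=> /(_ isT) /bigcupP[w sw]; rewrite inE -rcons_cons; apply/negP.
apply: fP; first by rewrite /= sz.
by move: sab sw; rewrite /srt /= => -> /andP[-> _].
Qed.

(** The label of [x_1, ..., x_m] is any element [p] of the set of
[x_2, ..., x_m] outside that of [x_1, ..., x_(m-1)]. The label of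
[x_2, ..., x_(m+1)] avoids the former set, which is down-closed and contains
[p], so it is not below [p]. *)
Lemma tuple_labelling_up {P : finType} {le : rel P} {j N} (p0 : P) :
  tuple_labelling (ideal le) (ideal_le le) j N -> tuple_labelling P le j.+1 N.
Proof.
case=> g gP.
pose f (t : seq 'I_N) := if t is a :: t' then
  odflt p0 [pick p in val (g t') :\: val (g (belast a t'))] else p0.
have fP a s b : size s = j -> sorted ltn (map val (a :: rcons s b)) ->
    f (a :: rcons s b) \in val (g (rcons s b)) :\: val (g (a :: s)).
  move=> sz sab; rewrite /f belast_rcons; case: pickP => [//|no].
  case/negP: (gP a s b sz sab); apply/subsetP => p pb.
  by apply: contraFT (no p) => pa; rewrite inE pa.
exists f => a s b; case: s => [//|c s] [sz] sab.
have [sac scb] : sorted ltn (map val (a :: c :: s)) /\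
                 sorted ltn (map val (c :: rcons s b)).
  move: sab; rewrite /= map_rcons rcons_path => /andP[-> /andP[-> ->]].
  by [].
have := fP c s b sz scb; rewrite inE => /andP[fNc _].
have := fP a (belast c s) (last c s); rewrite size_belast -lastI.
move=> /(_ sz sac); rewrite inE => /andP[_ fac].
apply: contraNN fNc => le_f.
by move/down_closedP: (valP (g (c :: s))); apply; [exact: le_f|].
Qed.

Lemma tuple_labelling_leq {P : finType} {le : rel P} {j M N} :
  M <= N -> tuple_labelling P le j N -> tuple_labelling P le j M.
Proof.
move=> leMN [f fP]; exists (fun y => f (map (widen_ord leMN) y)) => a s b sz sab.
rewrite map_rcons; apply: fP; first by rewrite size_map.
by rewrite -map_rcons -map_cons -map_comp.
Qed.

(** * Colourings and labellings *)

(** The product order on the box [[n]^q]. *)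
Definition profile_le q n : rel {ffun 'I_q -> 'I_n} :=
  fun f g => [forall a, f a <= g a].

Lemma profile_le_refl q n : reflexive (profile_le q n).
Proof. by move=> f; apply/forallP. Qed.

Lemma profile_le_trans q n : transitive (profile_le q n).
Proof.
move=> g f h /forallP fg /forallP gh; apply/forallP => a.
exact: leq_trans (fg a) (gh a).
Qed.

(** Recovers the increasing vertex sequence from an edge, on which a colouring
has to depend as a set. *)
Lemma enum_sorted_set {N} (y : seq 'I_N) :
  sorted ltn (map val y) -> enum [set v in y] = y.
Proof.
rewrite sorted_map => sy.
apply: (irr_sorted_eq (leT := relpre val ltn)) => //.
- by move=> v u w; apply: ltn_trans.
- by move=> v; rewrite /= ltnn.
- apply: sorted_filter => [v u w|]; first exact: ltn_trans.
  by rewrite -enumT -sorted_map val_enum_ord iota_ltn_sorted.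
- by move=> v; rewrite mem_enum inE.
Qed.

(** An edge of a monotone path, split into the two consecutive
[(k+1)]-vertex windows that a labelling compares. *)
Lemma take_window {T : Type} k (x : seq T) i : i + k.+2 <= size x ->
  exists a s b, [/\ size s = k, take k.+2 (drop i x) = a :: rcons s b,
    take k.+1 (drop i x) = a :: s & take k.+1 (drop i.+1 x) = rcons s b].
Proof.
move=> ik; have: k.+2 <= size (drop i x) by rewrite size_drop; lia.
rewrite -[i.+1]add1n -drop_drop.
case: (drop i x) => [//|a y] /=; rewrite drop0 ltnS => ky.
exists a, (take k y), (nth a y k); rewrite (take_nth a) // size_take.
by split => //; case: ifP => //; lia.
Qed.

(** The coordinate [a] of the label of [y] is the length of the longest
monotone path of colour [a] whose last vertices are [y]; it is less than the
forbidden length. An edge of colour [a] prolongs such a path by one. *)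
Lemma labelling_of_colouring k q n N :
  ~ forces_mono_path k.+2 q n.+1 N ->
  tuple_labelling {ffun 'I_q -> 'I_n.+1} (@profile_le q n.+1) k N.
Proof.
move=> /existsNP[c ncP].
(* [P a m y]: some monotone path with [m] edges, all of colour [a], ends in
   [y]. *)
pose P a m (y : seq 'I_N) := exists x : seq 'I_N,
  [/\ size x = m + k.+1, sorted ltn (map val x), drop m x = y &
      forall i, i < m -> c (path_edge k.+2 x i) = a].
have P_lt a m y : P a m y -> m < n.+1 \/ n.+1 < m.
  move=> [x [sx srt _ xa]].
  case: (ltngtP m n.+1) => [||mn]; [by left|by right|subst m].
  exfalso; apply: ncP; exists x; last by exists a.
  rewrite /increasing_vertices sx [in n.+1 + k.+2]addnS subn1 eqxx.
  by rewrite sorted_map in srt.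
have P0 a y : size y = k.+1 -> sorted ltn (map val y) -> P a 0 y.
  by move=> sy srt; exists y; split; rewrite ?drop0.
have PS a0 m a s b : size s = k -> sorted ltn (map val (a :: rcons s b)) ->
    c [set v in a :: rcons s b] = a0 -> P a0 m (a :: s) ->
    P a0 m.+1 (rcons s b).
  move=> sz srt ca [x [sx srtx dx xa]].
  have xE : x = take m x ++ a :: s by rewrite -dx cat_take_drop.
  have tm : size (take m x) = m by rewrite size_take sx; case: ifP => //; lia.
  exists (rcons x b); split.
  - by rewrite size_rcons sx.
  - have lx : last a x = last a s by rewrite xE last_cat.
    move: srt; rewrite map_rcons /= map_rcons rcons_path last_map => /andP[_ sb].
    case: x sx srtx lx {dx xa xE tm} => [|u x] //= _ srtx lx.
    by rewrite rcons_path srtx last_map lx.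
  - by rewrite xE rcons_cat drop_cat tm ltnNge leqnSn /= subSnn /= drop0.
  - move=> i; rewrite ltnS leq_eqVlt => /orP[/eqP ->|im].
    + rewrite /path_edge xE rcons_cat drop_cat tm ltnn subnn drop0 /=.
      by rewrite take_oversize // size_rcons sz.
    + rewrite -(xa i im) /path_edge; congr (c (finset _)).
      apply/funext => v; rewrite -cats1 drop_cat sx ifT; last by lia.
      by rewrite takel_cat // size_drop sx; lia.
pose len a y : 'I_n.+1 := [arg max_(m > ord0 | `[< P a m y >]) m].
exists (fun y => [ffun a => len a y]) => a s b sz srt.
pose a0 := c [set v in a :: rcons s b].
apply/negP => /forallP/(_ a0); rewrite !ffunE leqNgt; apply/negP/negPn.
have srta : sorted ltn (map val (a :: s)).
  by move: srt; rewrite /= map_rcons rcons_path => /andP[].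
rewrite /len; case: arg_maxnP => [|m /asboolP Pm _].
  by apply/asboolP; apply: P0 => //=; rewrite sz.
have PmS := PS a0 m a s b sz srt erefl Pm.
have mn : m.+1 < n.+1 by have := P_lt _ _ _ PmS; have := ltn_ord m; lia.
case: arg_maxnP => [|m' _ /(_ (Ordinal mn))]; last by apply; apply/asboolP.
apply/asboolP; apply: P0; first by rewrite size_rcons sz.
by move: srt; rewrite /= => /path_sorted.
Qed.

(** An edge is coloured by a coordinate of the label that rises across it.
Along a monochromatic path of length [n] this coordinate would rise [n] times,
reaching the value [n], which is out of range. *)
Lemma colouring_of_labelling k q n N :
  tuple_labelling {ffun 'I_q.+1 -> 'I_n} (@profile_le q.+1 n) k N ->
  ~ forces_mono_path k.+2 q.+1 n N.
Proof.
case=> f fP.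
pose rises (t : seq 'I_N) a := f (take k.+1 t) a < f (behead t) a.
move=> /(_ (fun e => odflt ord0 [pick a | rises (enum e) a])).
case=> x /andP[/eqP sx srt].
rewrite addnS subn1 /= addnS in sx.
rewrite -(@sorted_map _ _ val ltn) in srt.
case=> a0 mono.
have step i : i < n ->
    f (take k.+1 (drop i x)) a0 < f (take k.+1 (drop i.+1 x)) a0.
  move=> ltin; move: (mono i ltin); rewrite /path_edge.
  have [|a [s [b [sz tE taE tbE]]]] := @take_window _ k x i.
    by rewrite sx; lia.
  have srtw : sorted ltn (map val (a :: rcons s b)).
    by rewrite -tE map_take map_drop; apply/take_sorted/drop_sorted.
  rewrite tE taE tbE.
  (* Some coordinate rises because the second label is not below the first; the
     default colour [ord0] thus never creates a path. *)
  rewrite enum_sorted_set //; case: pickP => [a1|no] /=.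
    by rewrite /rises /= -cats1 takel_cat ?sz // -{1}sz take_size => + <-.
  have /negP[] := fP a s b sz srtw; apply/forallP => a1.
  have := no a1; rewrite /rises /= -cats1 takel_cat ?sz // -{1}sz take_size.
  by move/negbT; rewrite -leqNgt.
have {step} height i : i <= n -> i <= f (take k.+1 (drop i x)) a0.
  elim: i => // i IH ltin; exact: leq_ltn_trans (IH (ltnW ltin)) (step i ltin).
by have := leq_trans (height n (leqnn n)) (leqnn _); rewrite leqNgt ltn_ord.
Qed.

(** Uniformities of at least [3] leave at least one vertex in each tuple after
one passage to down-closed sets; this first passage is kept separate because
the size of the resulting poset is only [C(2n, n)] when [q = 2], much below the
generic bound [2^(n^2)]. *)
Lemma not_forces_ideal k q n N :
  ~ forces_mono_path k.+3 q.+1 n.+1 N <->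
  tuple_labelling (ideal (@profile_le q.+1 n.+1)) (ideal_le _) k N.
Proof.
split=> [/labelling_of_colouring | lab].
  apply: tuple_labelling_down; first exact: profile_le_refl.
  exact: profile_le_trans.
by apply/colouring_of_labelling/tuple_labelling_up => //; exact: [ffun => ord0].
Qed.

(** * Sizes and antichains *)

(** Vertices with equal labels would violate the condition by reflexivity. *)
Lemma labelling_size_le {P : finType} {le : rel P} {j N} :
  reflexive le -> transitive le ->
  tuple_labelling P le j N -> N <= iter j (expn 2) #|P|.
Proof.
elim: j P le => [|j IH] P le le_refl le_trans.
  case=> f fP; rewrite -[N in N <= _]card_ord.
  apply: (leq_card (fun v : 'I_N => f [:: v])) => u v fuv.
  have ltP (a b : 'I_N) : f [:: a] = f [:: b] -> ~~ (a < b).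
    move=> fab; apply/negP => ab; have := fP a [::] b erefl.
    by rewrite /= ab fab le_refl => /(_ isT).
  apply: ord_inj; apply/eqP; rewrite eqn_leq (leqNgt u) (leqNgt v).
  by rewrite (ltP u v fuv) (ltP v u (esym fuv)).
move=> /(tuple_labelling_down le_refl le_trans).
move=> /(IH _ _ (@ideal_le_refl _ le) (@ideal_le_trans _ le)) /leq_trans; apply.
rewrite iterSr; elim: j {IH} => [|j IHj] /=; first exact: card_ideal_le.
by rewrite leq_exp2l.
Qed.

(** The condition on [g] also makes it injective when [le] is reflexive, so its
[w] values are distinct. *)
Definition has_antichain (P : finType) (le : rel P) (w : nat) : Prop :=
  exists g : 'I_w -> P, forall i j, le (g i) (g j) -> i = j.

Lemma has_antichain_leq {P : finType} {le : rel P} {v w} :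
  v <= w -> has_antichain P le w -> has_antichain P le v.
Proof.
move=> vw [g gP]; exists (fun i => g (widen_ord vw i)) => i j /gP/(congr1 val) ij.
exact: val_inj.
Qed.

Lemma has_antichain_set {P : finType} {le : rel P} (A : {set P}) :
  {in A &, forall p q, le p q -> p = q} -> has_antichain P le #|A|.
Proof.
move=> Aanti; exists (fun i => enum_val i) => i j ij.
by apply: enum_val_inj; apply: Aanti ij; exact: enum_valP.
Qed.

(** Group the [2m] elements into [m] pairs. Each of the [2^m] ways of choosing
one element from every pair generates a down-closed set, and two different
choices generate incomparable sets because a chosen element is below no other
element of the antichain. *)
Lemma has_antichain_ideal {P : finType} {le : rel P} {m} :
  reflexive le -> transitive le ->
  has_antichain P le (m + m) -> has_antichain (ideal le) (ideal_le le) (2 ^ m).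
Proof.
move=> le_refl le_trans [g gP].
pose e (S : {set 'I_m}) i := g (if i \in S then lshift m i else rshift m i).
pose D S := [set p | [exists i, le p (e S i)]].
have dcD S : down_closed le (D S).
  apply/down_closedP => p q pq; rewrite !inE => /existsP[i qi].
  by apply/existsP; exists i; apply: le_trans qi.
rewrite -[m in 2 ^ m]card_ord -cardsT -card_powerset powersetT.
pose F S : ideal le := exist _ (D S) (dcD S).
have FP S T : ideal_le le (F S) (F T) -> S = T.
  move=> /subsetP sST; apply/setP => i.
  have /sST : e S i \in val (F S) by rewrite inE; apply/existsP; exists i.
  rewrite inE => /existsP[j /gP].
  case: (boolP (i \in S)); case: (boolP (j \in T)) => jT iS /eqP;
    rewrite ?eq_shift // => /eqP ij; subst j; first by rewrite jT.
  by rewrite (negbTE jT).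
have Finj : injective F by move=> S T FST; apply: FP; rewrite FST ideal_le_refl.
rewrite -(card_imset _ Finj); apply: has_antichain_set => D1 D2 /imsetP[S _ ->].
by move=> /imsetP[T _ ->] /FP ->.
Qed.

(** The factor [4] is what makes the induction work: an antichain of size
[4y] in [P] gives one of size [2^(2y)], and [2^(2y) >= 4 * 2^y] when [y >= 2].
On vertices, any enumeration of an antichain is a labelling. *)
Lemma labelling_of_antichain {P : finType} {le : rel P} j {y} :
  reflexive le -> transitive le -> 2 <= y -> has_antichain P le (4 * y) ->
  tuple_labelling P le j (iter j (expn 2) y).
Proof.
elim: j P le y => [|j IH] P le y le_refl le_trans y2 anti.
  have [g gP] : has_antichain P le y by apply: has_antichain_leq anti; lia.
  have x0 : 'I_y by exact: Ordinal y2.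
  exists (fun s => g (head x0 s)) => a s b /size0nil -> /=; rewrite andbT => ab.
  by apply/negP => /gP E; rewrite E ltnn in ab.
have [p0 _] : exists p0 : P, true.
  have lt0 : 0 < 4 * y by lia.
  by case: anti => g _; exists (g (Ordinal lt0)).
apply: tuple_labelling_up p0 _; rewrite iterSr.
apply: (IH _ _ _ (@ideal_le_refl _ le) (@ideal_le_trans _ le)).
  by rewrite (leq_exp2l 1) // ltnW.
have : has_antichain (ideal le) (ideal_le le) (2 ^ (2 * y)).
  by apply: has_antichain_ideal => //; rewrite (_ : _ + _ = 4 * y) //; lia.
apply: has_antichain_leq; rewrite (_ : 4 = 2 ^ 2) // -expnD leq_exp2l //; lia.
Qed.

(** Down-closed sets of equal cardinality are incomparable, and there are only
[|P| + 1] cardinalities. *)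
Lemma ideal_level_antichain {P : finType} {le : rel P} {w} :
  w * #|P|.+1 <= #|{: ideal le}| -> has_antichain (ideal le) (ideal_le le) w.
Proof.
case: w => [_|w wP].
  have none : 'I_0 -> ideal le by case.
  by exists none; case.
pose level (s : 'I_#|P|.+1) := [set D : ideal le | #|val D| == s].
have [s ws] : exists s, w.+1 <= #|level s|.
  apply/existsP; apply: contraTT wP => /existsPn small; rewrite -ltnNge.
  pose size_of (D : ideal le) : 'I_#|P|.+1 := inord #|val D|.
  rewrite -sum1_card (partition_big size_of predT) //=.
  apply: (@leq_ltn_trans (\sum_(s < #|P|.+1) w)); last first.
    by rewrite sum_nat_const card_ord mulnC ltn_mul2r ltnSn.
  apply: leq_sum => s _; have := small s; rewrite -ltnNge ltnS; apply: leq_trans.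
  rewrite sum1_card; apply: subset_leq_card; apply/subsetP => D.
  by rewrite !inE => /eqP <- /=; rewrite inordK // ltnS max_card.
apply: has_antichain_leq ws _; apply: has_antichain_set => D E.
rewrite !inE => /eqP cD /eqP cE DE; apply/val_inj/eqP.
by rewrite eqEcard [_ \subset _]DE cD cE leqnn.
Qed.

(** * Down-closed sets of the square *)

Lemma card_profiles q n : #|{ffun 'I_q -> 'I_n}| = n ^ q.
Proof. by rewrite card_ffun !card_ord. Qed.

Definition box_point {n} (i j : 'I_n) : {ffun 'I_2 -> 'I_n} :=
  [ffun a => if a == ord0 then i else j].

Lemma box_point_le {n} (i i' j j' : 'I_n) :
  profile_le 2 n (box_point i j) (box_point i' j') = (i <= i') && (j <= j').
Proof.
apply/forallP/andP => [le_ij|[le_i le_j] a]; last by rewrite !ffunE; case: ifP.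
by have := le_ij ord0; have := le_ij ord_max; rewrite !ffunE.
Qed.

Lemma box_pointE {n} (p : {ffun 'I_2 -> 'I_n}) :
  p = box_point (p ord0) (p ord_max).
Proof.
apply/ffunP => a; rewrite ffunE; case: eqP => [->//|/eqP a0]; congr (p _).
by apply: val_inj; case: a a0 => [[|[|]]].
Qed.

Lemma upsets_nested {n} (U V : {set 'I_n}) :
  (forall i j : 'I_n, i <= j -> i \in U -> j \in U) ->
  (forall i j : 'I_n, i <= j -> i \in V -> j \in V) ->
  (U \subset V) || (V \subset U).
Proof.
move=> upU upV; case: (boolP (U \subset V)) => //= /subsetPn[i iU iV].
apply/subsetP => j jV; apply: upU iU; rewrite leqNgt; apply: contra iV.
by move=> /ltnW ji; apply: upV jV.
Qed.

(** A down-closed subset of the square is determined by the number of points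
missing from each column, since the points missing from a column form an
up-closed set of a chain; these numbers increase from left to right. *)
Lemma card_ideal_box_le n :
  #|{: ideal (@profile_le 2 n)}| <= 'C(n + n, n).
Proof.
rewrite -card_sorted_tuples.
pose out (D : ideal (@profile_le 2 n)) i :=
  [set j | box_point i j \notin val D].
have up D (i i' j j' : 'I_n) :
    i <= i' -> j <= j' -> j \in out D i -> j' \in out D i'.
  move=> le_i le_j; rewrite !inE; apply: contra => /(down_closedP (valP D)); apply.
  by rewrite box_point_le le_i.
pose h (D : ideal (@profile_le 2 n)) : n.-tuple 'I_n.+1 :=
  [tuple inord #|out D i| | i < n].
have out_n D i : #|out D i| < n.+1.
  by rewrite ltnS -[X in _ <= X](card_ord n) max_card.
have h_inj : injective h.
  move=> D E hDE; have outE i : out D i = out E i.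
    have cDE : #|out D i| = #|out E i|.
      move/(congr1 (fun t => val (tnth t i))): hDE.
      by rewrite !tnth_mktuple /= !inordK.
    have upi F j j' := up F i i j j' (leqnn i).
    case/orP: (upsets_nested _ _ (upi D) (upi E)) => sub; last apply/esym.
      by apply/eqP; rewrite eqEcard sub cDE leqnn.
    by apply/eqP; rewrite eqEcard sub cDE leqnn.
  apply/val_inj/setP => p; rewrite (box_pointE p).
  by have /setP/(_ (p ord_max)) := outE (p ord0); rewrite !inE => /negb_inj.
rewrite -cardsT -(card_imset _ h_inj); apply: subset_leq_card.
apply/subsetP => _ /imsetP[D _ ->]; rewrite inE /= -map_comp sorted_map.
have : sorted leq (map val (enum 'I_n)) by rewrite val_enum_ord iota_sorted.
rewrite sorted_map; apply: sub_sorted => i i' /= le_i; rewrite !inordK //.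
by apply: subset_leq_card; apply/subsetP => j; apply: up.
Qed.

(** Conversely every nondecreasing sequence of column deficits is realised, by
removing that many points from the top of each column. *)
Lemma card_ideal_box_ge n :
  'C(n + n, n) <= #|{: ideal (@profile_le 2 n)}|.
Proof.
rewrite -card_sorted_tuples; set T := [set t | _].
pose D (t : n.-tuple 'I_n.+1) :=
  [set p : {ffun 'I_2 -> 'I_n} | p ord_max + tnth t (p ord0) < n].
have dcD t : t \in T -> down_closed (@profile_le 2 n) (D t).
  rewrite inE => srt; apply/down_closedP => p q /forallP pq; rewrite !inE.
  apply: leq_ltn_trans; apply: leq_add; first exact: pq.
  have := sorted_leq_nth leq_trans leqnn 0 srt.
  move=> /(_ (p ord0) (q ord0)); rewrite !inE size_map size_tuple !ltn_ord.
  move=> /(_ isT isT (pq _)).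
  by rewrite !(nth_map ord0) ?size_tuple // -!tnth_nth.
have D_inj : injective D.
  move=> t u tu; apply: eq_from_tnth => i; apply: ord_inj.
  have ge (v w : n.-tuple 'I_n.+1) : D v = D w -> tnth w i <= tnth v i.
    move=> vw; rewrite leqNgt; apply/negP => lt_vw.
    have jn : n - tnth w i < n by have := ltn_ord (tnth w i); lia.
    have /setP/(_ (box_point i (Ordinal jn))) := vw.
    by rewrite !inE !ffunE /=; have := ltn_ord (tnth w i); lia.
  by apply/eqP; rewrite eqn_leq !ge.
rewrite -(card_imset _ D_inj) card_sig; apply: subset_leq_card.
by apply/subsetP => _ /imsetP[t /dcD dct ->].
Qed.

(** * Central binomial coefficients *)

Lemma central_bin_rec n :
  n.+1 * 'C(n.+1 + n.+1, n.+1) = 2 * (2 * n + 1) * 'C(n + n, n).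
Proof.
have h1 := mul_bin_diag (n.+1 + n.+1) n.
have h2 := mul_bin_down (n + n).+1 n.
have h3 : (n + n).+1 - n = n.+1 by lia.
move: h1 h2; rewrite h3 addnS addSn /= => h1 h2.
have : n.+1 * (n.+1 * 'C((n + n).+2, n.+1)) =
       n.+1 * (2 * (2 * n + 1) * 'C(n + n, n)).
  rewrite -h1 mulnCA -h2; ring.
by move/eqP; rewrite eqn_mul2l /= => /eqP.
Qed.

Lemma central_bin_lt n : 0 < n -> 'C(n + n, n) < 2 ^ (n + n).
Proof.
case: n => // n _; elim: n => [//|n IH].
have := central_bin_rec n.+1; move: IH.
set c := 'C(_, _); set d := 'C(_, _).
have -> : 2 ^ (n.+2 + n.+2) = 4 * 2 ^ (n.+1 + n.+1).
  by rewrite -(expnD 2 2); congr (2 ^ _); lia.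
set e := 2 ^ _ => ce rec; rewrite -(ltn_pmul2l (ltn0Sn n.+1)) rec.
have : n.+2 * c < n.+2 * e by rewrite ltn_pmul2l.
lia.
Qed.

Lemma central_bin_ge n : 0 < n -> 2 ^ (n + n) <= 2 * n * 'C(n + n, n).
Proof.
case: n => // n _; elim: n => [//|n IH].
have := central_bin_rec n.+1; move: IH.
set c := 'C(_, _); set d := 'C(_, _).
have -> : 2 ^ (n.+2 + n.+2) = 4 * 2 ^ (n.+1 + n.+1).
  by rewrite -(expnD 2 2); congr (2 ^ _); lia.
set e := 2 ^ _ => ce rec; rewrite -mulnA rec; lia.
Qed.

(** * Bounds on the Ramsey numbers *)

Lemma path_ramsey_least k q n N :
  forces_mono_path k q n N -> least_forcing k q n (path_ramsey k q n).
Proof.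
move=> fN; apply: (xgetPex 0).
have exN : exists M, `[< forces_mono_path k q n M >] by exists N; apply/asboolP.
case: (ex_minnP exN) => M /asboolP fM minM; exists M; split=> // L fL.
by apply/minM/asboolP.
Qed.

Lemma ltn_iter_exp2 j : {homo iter j (expn 2) : x y / x < y}.
Proof. by move=> x y xy; elim: j => //= j IH; rewrite ltn_exp2l. Qed.

(** Too large a vertex set would carry an injective labelling by too small a
poset. *)
Lemma forces_mono_path_large k n : 0 < n ->
  forces_mono_path k.+3 2 n (iter k (expn 2) 'C(n + n, n)).+1.
Proof.
case: n => // n _; apply: contrapT => /not_forces_ideal lab.
have := labelling_size_le (@ideal_le_refl _ _) (@ideal_le_trans _ _) lab.
rewrite leqNgt => /negP; apply; rewrite ltnS.
elim: k {lab} => [|k IH]; first exact: card_ideal_box_le.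
by rewrite /= leq_exp2l.
Qed.

Lemma path_ramsey_gt k n y : 0 < n -> 2 <= y ->
  4 * y * (n ^ 2).+1 <= 'C(n + n, n) ->
  iter k (expn 2) y < path_ramsey k.+3 2 n.
Proof.
move=> n0 y2 yC; rewrite ltnNge; apply/negP => le_y.
case: n => // n in n0 yC le_y *.
have : ~ forces_mono_path k.+3 2 n.+1 (path_ramsey k.+3 2 n.+1).
  apply/not_forces_ideal/(tuple_labelling_leq le_y).
  apply: labelling_of_antichain => //.
  - exact: ideal_le_refl.
  - exact: ideal_le_trans.
  apply: ideal_level_antichain; rewrite card_profiles.
  exact: leq_trans yC (card_ideal_box_ge _).
apply; have := forces_mono_path_large k n.+1 n0.
by move=> /path_ramsey_least[].
Qed.

(** * Asymptotics *)

Lemma floor_sqrt n : exists s, s ^ 2 <= n < s.+1 ^ 2.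
Proof.
elim: n => [|n [s /andP[sn ns]]]; first by exists 0.
by have [lt|ge] := ltnP n.+1 (s.+1 ^ 2); [exists s|exists s.+1]; nia.
Qed.

(** Any bound of the form [2^(o(n))] would do; an integer square root keeps the
exponent a natural number and tends to [0] visibly after division by [n]. The
left-hand side is the total loss in the lower bound: [2n] from the central
binomial coefficient, [n^2 + 1] from the choice of a level, [4] from
[labelling_of_antichain]. *)
Lemma poly_le_exp2 n s : 0 < n -> n < s.+1 ^ 2 ->
  8 * n * (n ^ 2).+1 <= 2 ^ (4 + 6 * s).
Proof.
move=> n0 ns; have s2 : s.+1 <= 2 ^ s by exact: ltn_expl.
have n2 : n <= 4 ^ s by rewrite (_ : 4 = 2 ^ 2) // -expnM mulnC expnM; nia.
rewrite expnD (_ : 6 * s = 2 * s * 3) ?expnM; last by lia.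
(* Now [n <= 4^s] bounds [16 n^3] by [2^(4 + 6s)]. *)
apply: (@leq_trans (16 * n ^ 3)); first by nia.
by apply: leq_mul => //; rewrite leq_exp2r.
Qed.

Local Open Scope classical_set_scope.
Local Open Scope ring_scope.

Lemma natr_iter_exp2 (R : realType) j m :
  (iter j (expn 2) (2 ^ m)%N)%:R = tower j.+2 (m%:R : R).
Proof.
rewrite /tower; elim: j => [|j IH] /=; first by rewrite natrX powR_mulrn.
by rewrite natrX -powR_mulrn // IH.
Qed.

(** The [m]-fold iterated logarithm of [A] is defined and lies between [u] and
[v], one logarithm being taken at each step of the induction. *)
Lemma tower_surj (R : realType) m (u v A : R) :
  tower m.+1 u <= A <= tower m.+1 v ->
  exists2 x, u <= x <= v & A = tower m.+1 x.
Proof.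
have ln2 : 0 < ln (2%:R : R) by rewrite ln_gt0 // ltr1n.
rewrite /tower /=; elim: m A => [|m IH] A /=; first by move=> Auv; exists A.
move=> /andP[uA Av].
have A0 : 0 < A by apply: lt_le_trans uA; rewrite powR_gt0.
have AE : A = 2%:R `^ (ln A / ln 2%:R).
  by rewrite /powR pnatr_eq0 /= divfK ?gt_eqF // lnK.
have [] := IH (ln A / ln 2%:R).
  rewrite ler_pdivlMr // ler_pdivrMr // -!ln_powR !ler_ln ?posrE ?powR_gt0 //.
  exact/andP.
by move=> x xuv xE; exists x => //; rewrite AE xE.
Qed.

(** The bound [14] guarantees that [2n - (4 + 6s)] is positive, where [s] is
the integer square root of [n]. *)
Lemma path_ramsey_exponent (R : realType) k n : (14 <= n)%N ->
  exists2 e : R, 0 <= e <= 10%:R * Num.sqrt (n%:R^-1) &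
    (path_ramsey k.+3 2 n)%:R = tower k.+2 ((2 - e) * n%:R).
Proof.
move=> n14; have n0 : (0 < n)%N by lia.
have [s /andP[sn ns]] := floor_sqrt n.
have s3 : (4 + 6 * s < n + n)%N.
  have : (6 * s <= s ^ 2 + 9)%N by have [|] := leqP s 3; nia.
  lia.
(* [2^m] is the value of [y] in [path_ramsey_gt]. *)
set m := (n + n - (4 + 6 * s))%N.
have yC : (4 * 2 ^ m * (n ^ 2).+1 <= 'C(n + n, n))%N.
  rewrite -(@leq_pmul2l (2 * n)); last by lia.
  apply: leq_trans _ (central_bin_ge n n0).
  have -> : (2 ^ (n + n) = 2 ^ m * 2 ^ (4 + 6 * s))%N.
    by rewrite -expnD; congr (2 ^ _)%N; rewrite /m; lia.
  have := poly_le_exp2 n s n0 ns; set u := (2 ^ (_ + _))%N; set v := (2 ^ m)%N.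
  rewrite -(@leq_pmul2l v) ?expn_gt0 //; lia.
have m1 : (2 <= 2 ^ m)%N by rewrite (leq_exp2l 1) //; rewrite /m; lia.
have lo := ltnW (path_ramsey_gt k n _ n0 m1 yC).
have hi : (path_ramsey k.+3 2 n <= iter k (expn 2) (2 ^ (n + n)))%N.
  have fN := forces_mono_path_large k n n0.
  have [_ /(_ _ fN)/leq_trans] := path_ramsey_least _ _ _ _ fN; apply.
  by apply/ltn_iter_exp2/central_bin_lt.
have [] := tower_surj R k.+1 m%:R (n + n)%:R (path_ramsey k.+3 2 n)%:R.
  by rewrite -!natr_iter_exp2 !ler_nat lo hi.
move=> x /andP[mx xn] ->; exists (2 - x / n%:R); last first.
  by congr tower; rewrite opprB addrCA subrr addr0 divfK // pnatr_eq0; lia.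
have nR : 0 < n%:R :> R by rewrite ltr0n.
set r := Num.sqrt (n%:R : R).
have rr : r * r = n%:R by rewrite -expr2 sqr_sqrtr ?ler0n.
have r0 : 0 <= r by exact: sqrtr_ge0.
have sr : s%:R <= r.
  by rewrite -[s%:R]ger0_norm // -sqrtr_sqr ler_wsqrtr // -natrX ler_nat.
have r1 : 1 <= r by rewrite -sqrtr1 ler_wsqrtr // ler1n.
have mE : (m%:R : R) = n%:R + n%:R - (4 + 6 * s%:R).
  by rewrite /m natrB ?(ltnW s3) // (natrD _ n n) (natrD _ 4 (6 * s)) natrM.
rewrite sqrtrV ?ler0n // -/r (_ : _ / r = 10 * r / n%:R); last first.
  by rewrite -rr; field; lra.
move: xn mx; rewrite mE natrD => xn mx.
rewrite subr_ge0 ler_pdivrMr // ler_pdivlMr // mulrBl divfK ?gt_eqF //.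
by apply/andP; split; lra.
Qed.

Theorem corollary2 (R : realType) (k : nat) (hk : (3 <= k)%N) :
  exists2 eps : nat -> R,
    eps n @[n --> \oo] --> (0 : R) &
    \forall n \near \oo,
      (path_ramsey k 2 n)%:R = tower (k - 1)%N ((2 - eps n) * n%:R).
Proof.
case: k hk => [|[|[|k]]] // _.
have /choice[eps epsP] : forall n, exists e : R, (14 <= n)%N ->
    0 <= e <= 10%:R * Num.sqrt (n%:R^-1) /\
    (path_ramsey k.+3 2 n)%:R = tower k.+2 ((2 - e) * n%:R).
  move=> n; have [n14|_] := leqP 14 n; last by exists 0.
  by have [e] := path_ramsey_exponent R k n n14; exists e.
exists eps; last first.
  near=> n; have [|_ ->] := epsP n; first by near: n; exact: nbhs_infty_ge.
  by rewrite subn1.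
apply: (@squeeze_cvgr _ _ _ _ (fun=> 0) (fun n => 10%:R * Num.sqrt (n%:R^-1))).
- by near=> n; have [|->//] := epsP n; near: n; exact: nbhs_infty_ge.
- exact: cvg_cst.
have invn : (n%:R^-1 : R) @[n --> \oo] --> (0 : R).
  by rewrite -cvg_shiftS; exact: cvg_harmonic.
rewrite -[0](mulr0 10%:R) -[X in _ * X](sqrtr0 R).
apply: cvgMr; apply: (continuous_cvg _ _ invn); exact: sqrt_continuous.
Unshelve. all: by end_near.
Qed.
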